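(* Let $L\subseteq \mathrm{Fm}(\Box)$ be a normal unimodal logic such that the class of models $\mathsf{Mod}(L)$ admits definable filtration. Then: (1) the class of models $\mathsf{Mod}(L^{\boxplus})$ admits definable filtration; (2) hence the logic $L^{\boxplus}$ has the finite model property; (3) hence the logic $L^{\boxplus}$ is Kripke complete.
   Context: Formulas. For a finite alphabet $\Sigma$ of indices, $\mathrm{Fm}(\Sigma)$ is the set of modal formulas built from propositional variables $p_0,p_1,\dots$ using $\bot$, $\to$ and unary modalities $[e]$, $e\in\Sigma$. In the unimodal case the modality is $\Box$; in the bimodal language $\mathrm{Fm}(\Box,\boxplus)$ there are two modalities $\Box,\boxplus$. A set $\Gamma$ of formulas is Sub-closed if it contains all subformulas of its members. Semantics. A ($\Sigma$-)frame is $F=(W,(R_e)_{e\in\Sigma})$ with $W\neq\varnothing$ and $R_e\subseteq W\times W$; a model on $F$ is $M=(F,V)$ with $V(p)\subseteq W$ for each variable $p$. Truth $M,x\models\varphi$ is standard ($M,x\models[e]\varphi$ iff $M,y\models\varphi$ for all $y$ with $xR_ey$). $M\models\varphi$ means truth at all points; $F\models\varphi$ means $M\models\varphi$ for all models $M$ on $F$. A (normal) logic over $\Sigma$ is a set of $\Sigma$-formulas containing all classical tautologies and all $[e](p\to q)\to([e]p\to[e]q)$, closed under modus ponens, substitution and necessitation. $\mathsf{Mod}(L)$ is the class of all models $M$ with $M\models L$. A logic is Kripke complete if it is the set of all formulas valid in some class of frames; it has the finite model property if it is the set of all formulas valid in some class of finite frames. The logic $L^{\boxplus}$. For a normal unimodal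 logic $L\subseteq\mathrm{Fm}(\Box)$, $L^{\boxplus}\subseteq\mathrm{Fm}(\Box,\boxplus)$ is the smallest normal logic containing $L$ and the axioms $\boxplus p\to\Box p$, $\ \boxplus p\to\Box\boxplus p$, $\ \boxplus(p\to\Box p)\to(\Box p\to\boxplus p)$. Filtration. Let $M=(W,(R_e)_{e\in\Sigma},V)$ be a model. For a set $\Phi$ of formulas, $x\sim_\Phi y$ iff for all $\varphi\in\Phi$: $M,x\models\varphi\Leftrightarrow M,y\models\varphi$. Let $\Gamma$ be a finite Sub-closed set of formulas. A $\Gamma$-filtration of $M$ is a model $\widehat M=(\widehat W,(\widehat R_e)_{e\in\Sigma},\widehat V)$ such that: $\widehat W=W/{\sim}$ for some equivalence relation $\sim$ on $W$ with finitely many classes and with $\sim\,\subseteq\,\sim_\Gamma$; for all variables $p\in\Gamma$ and $x\in W$, $\widehat M,\widehat x\models p$ iff $M,x\models p$, where $\widehat x$ is the $\sim$-class of $x$; and for each $e\in\Sigma$, $R^{\min}_{\sim,e}\subseteq\widehat R_e\subseteq R^{\max}_{\Gamma,e}$, where $\widehat x\,R^{\min}_{\sim,e}\,\widehat y$ iff there are $x'\sim x$, $y'\sim y$ with $x'R_ey'$, and $\widehat x\,R^{\max}_{\Gamma,e}\,\widehat y$ iff for every formula $[e]\varphi\in\Gamma$, $M,x\models[e]\varphi$ implies $M,y\models\varphi$. The filtration is definable if $\sim\,=\,\sim_\Phi$ for some finite set of formulas $\Phi$. A class of models $\mathcal M$ admits definable filtration if for every finite Sub-closed set of formulas $\Gamma$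 and every $M\in\mathcal M$ there is a model in $\mathcal M$ that is a definable $\Gamma$-filtration of $M$. *)

(* Defs.v *)
(* Stdlib only; finite sets of formulas are represented by lists, of which only
   the membership predicate [In] is ever used. *)
From Stdlib Require Import List FinFun RelationClasses.

Set Implicit Arguments.
Unset Strict Implicit.

(** * Formulas *)

Inductive form (S : Type) : Type :=
| Var : nat -> form S
| Bot : form S
| Imp : form S -> form S -> form S
| Box : S -> form S -> form S.

Arguments Var {S} _.
Arguments Bot {S}.

Fixpoint subst (S : Type) (s : nat -> form S) (f : form S) : form S :=
  match f with
  | Var p => s p
  | Bot => Bot
  | Imp a b => Imp (subst s a) (subst s b)
  | Box e a => Box e (subst s a)
  end.

Fixpoint subformulas (S : Type) (f : form S) : list (form S) :=
  f :: match f with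
       | Var _ | Bot => nil
       | Imp a b => subformulas a ++ subformulas b
       | Box _ a => subformulas a
       end.

Definition sub_closed (S : Type) (G : list (form S)) : Prop :=
  forall f g, In f G -> In g (subformulas f) -> In g G.

(* Translation along a map of alphabets. *)
Fixpoint rename (S T : Type) (h : S -> T) (f : form S) : form T :=
  match f with
  | Var p => Var p
  | Bot => Bot
  | Imp a b => Imp (rename h a) (rename h b)
  | Box e a => Box (h e) (rename h a)
  end.

(** * Frames and models *)

Record frame (S : Type) : Type := Frame {
  world :> Type;
  world_inhabited : inhabited world;
  acc : S -> world -> world -> Prop
}.

Record model (S : Type) : Type := Model {
  base :> frame S;
  val : nat -> base -> Prop
}.

Arguments acc {S} _ _ _ _.
Arguments val {S} _ _ _.

Fixpoint sat (S : Type) (M : model S) (x : M) (f : form S) : Prop :=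
  match f with
  | Var p => val M p x
  | Bot => False
  | Imp a b => sat x a -> sat x b
  | Box e a => forall y : M, acc M e x y -> sat y a
  end.

Definition true_in (S : Type) (M : model S) (f : form S) : Prop :=
  forall x : M, sat x f.

Definition valid (S : Type) (F : frame S) (f : form S) : Prop :=
  forall V : nat -> F -> Prop, true_in (Model V) f.

(** * Normal logics *)

(* Variables and boxed formulas are the propositional atoms of [f], valued by [v]. *)
Fixpoint prop_eval (S : Type) (v : form S -> bool) (f : form S) : bool :=
  match f with
  | Bot => false
  | Imp a b => implb (prop_eval v a) (prop_eval v b)
  | Var _ | Box _ _ => v f
  end.

Definition tautology (S : Type) (f : form S) : Prop :=
  forall v : form S -> bool, prop_eval v f = true.

Definition axiomK (S : Type) (e : S) : form S :=
  Imp (Box e (Imp (Var 0) (Var 1))) (Imp (Box e (Var 0)) (Box e (Var 1))).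

Record normal_logic (S : Type) (L : form S -> Prop) : Prop := {
  nl_taut : forall f, tautology f -> L f;
  nl_K : forall e, L (axiomK e);
  nl_mp : forall f g, L (Imp f g) -> L f -> L g;
  nl_subst : forall s f, L f -> L (subst s f);
  nl_nec : forall e f, L f -> L (Box e f)
}.

Definition Mod (S : Type) (L : form S -> Prop) (M : model S) : Prop :=
  forall f, L f -> true_in M f.

Definition kripke_complete (S : Type) (L : form S -> Prop) : Prop :=
  exists C : frame S -> Prop,
    forall f, L f <-> (forall F, C F -> valid F f).

Definition finite_model_property (S : Type) (L : form S -> Prop) : Prop :=
  exists C : frame S -> Prop,
    (forall F, C F -> Finite F) /\
    (forall f, L f <-> (forall F, C F -> valid F f)).

(** * The logic [L^boxplus] *)

(* The unimodal alphabet is [unit]; the bimodal one is the following. *)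
Inductive bimod : Set := box | boxplus.

Definition embed : form unit -> form bimod := rename (fun _ => box).

(* [L^boxplus], as the intersection of all normal logics containing [L] and the
   three axioms. *)
Definition Lplus (L : form unit -> Prop) (f : form bimod) : Prop :=
  forall L' : form bimod -> Prop,
    normal_logic L' ->
    (forall g, L g -> L' (embed g)) ->
    L' (Imp (Box boxplus (Var 0)) (Box box (Var 0))) ->
    L' (Imp (Box boxplus (Var 0)) (Box box (Box boxplus (Var 0)))) ->
    L' (Imp (Box boxplus (Imp (Var 0) (Box box (Var 0))))
            (Imp (Box box (Var 0)) (Box boxplus (Var 0)))) ->
    L' f.

(** * Filtration *)

(* The set of classes of [sim]; each class is literally a subset of [W]. *)
Definition quot (W : Type) (sim : W -> W -> Prop) : Type :=
  {A : W -> Prop | exists x, A = sim x}.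

Definition cls (W : Type) (sim : W -> W -> Prop) (x : W) : quot sim :=
  exist _ (sim x) (ex_intro _ x eq_refl).

Lemma quot_inhabited (W : Type) (sim : W -> W -> Prop) :
  inhabited W -> inhabited (quot sim).
Proof. intros [x]. exact (inhabits (cls sim x)). Qed.

Definition quot_model (S : Type) (M : model S) (sim : M -> M -> Prop)
    (R : S -> quot sim -> quot sim -> Prop) (V : nat -> quot sim -> Prop) : model S :=
  @Model S (Frame (quot_inhabited sim (world_inhabited M)) R) V.

Definition equiv_by (S : Type) (M : model S) (Phi : list (form S)) (x y : M) : Prop :=
  forall f, In f Phi -> (sat x f <-> sat y f).

Definition Rmin (S : Type) (M : model S) (sim : M -> M -> Prop) (e : S) (x y : M) : Prop :=
  exists x' y', sim x x' /\ sim y y' /\ acc M e x' y'.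

Definition Rmax (S : Type) (M : model S) (G : list (form S)) (e : S) (x y : M) : Prop :=
  forall f, In (Box e f) G -> sat x (Box e f) -> sat y f.

(* [quot_model R V] is a [G]-filtration of [M].  Since [cls sim] is onto, the
   inclusions between relations on the quotient are stated on representatives. *)
Record filtration (S : Type) (G : list (form S)) (M : model S) (sim : M -> M -> Prop)
    (R : S -> quot sim -> quot sim -> Prop) (V : nat -> quot sim -> Prop) : Prop := {
  fil_equiv : Equivalence sim;
  fil_finite : Finite (quot sim);
  fil_refine : forall x y, sim x y -> equiv_by G x y;
  fil_val : forall p, In (Var p) G ->
    forall x : M, @sat S (quot_model R V) (cls sim x) (Var p) <-> sat x (Var p);
  fil_min : forall e x y, Rmin sim e x y -> R e (cls sim x) (cls sim y);
  fil_max : forall e x y, R e (cls sim x) (cls sim y) -> Rmax G e x y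
}.

Definition definable (S : Type) (M : model S) (sim : M -> M -> Prop) : Prop :=
  exists Phi : list (form S), forall x y, sim x y <-> equiv_by Phi x y.

Definition admits_definable_filtration (S : Type) (C : model S -> Prop) : Prop :=
  forall (G : list (form S)) (M : model S), sub_closed G -> C M ->
    exists (sim : M -> M -> Prop) (R : S -> quot sim -> quot sim -> Prop)
           (V : nat -> quot sim -> Prop),
      filtration G R V /\ definable sim /\ C (quot_model R V).

(* Main.v *)
From Stdlib Require Import List FinFun RelationClasses Relations Cantor.
From Stdlib Require Import Classical ClassicalEpsilon.
From Stdlib Require Import FunctionalExtensionality PropExtensionality ProofIrrelevance.
Require Import Defs.

(** Let [M] be a model of [Lplus L] and [G] a finite subformula-closed set.
    Replace each formula of [G] by a fresh variable; the [box]-reduct of [M]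
    then becomes a unimodal model of [L], because [Lplus L] contains [L] and is
    closed under substitution.  By assumption it has a definable filtration,
    with some relation [R] on the classes.  Interpreting [box] by [R] and
    [boxplus] by the transitive closure of [R] gives the filtration of [M].
    The two bounds on the new relation are the two halves of the axiomatics of
    [boxplus]:
    - it contains every [boxplus]-step of [M] ([boxplus_reachable]), because
      the set of points whose class is reachable from a given class is a union
      of finitely many definable classes, hence definable, and the induction
      axiom applies to the formula that defines it;
    - it transfers [Box boxplus a] correctly ([reachable_boxplus]), because
      [boxplus p -> box p] and [boxplus p -> box (boxplus p)] propagate both
      [a] and [Box boxplus a] along the steps of [R].

    The quotient must also satisfy the bimodal substitution instances of [L],
    whereas the assumption provides only a unimodal model of [L].  It therefore
    has to be arranged that the frame of the filtration validates [L].
    This is [frame_filtration]: merge modally equivalent points of the filtered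
    model.  The outcome is still a definable filtration of [M], as the new
    classes are unions of old ones; and in a finite model whose points are
    separated by formulas every subset is definable, so every valuation is a
    substitution and truth of [L] becomes validity ([differentiated_valid]).
    Once the frame validates [L], its expansion by the transitive closure
    validates [Lplus L] ([trans_frame_valid]).

    The finite model property follows for every normal logic in countably many
    formulas whose models admit definable filtration: the canonical model
    refutes each non-theorem ([canonical_refutation]), and a filtration of it
    through the subformulas, onto a frame of the logic, is a finite frame that
    refutes it too ([definable_filtration_fmp]). *)

Set Implicit Arguments.
Unset Strict Implicit.

(** * Truth under substitution and renaming *)

Definition Neg (S : Type) (a : form S) : form S := Imp a Bot.

Lemma sat_subst (S : Type) (M : model S) (s : nat -> form S) (U : nat -> M -> Prop)
    (hU : forall p x, U p x <-> sat x (s p)) (f : form S) :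
  forall x : M, @sat S (Model U) x f <-> sat x (subst s f).
Proof.
  induction f as [p| |a IHa b IHb|e a IHa]; intros x; simpl.
  - apply hU.
  - tauto.
  - rewrite <- IHa, <- IHb. tauto.
  - split; intros h y hy; apply IHa, h, hy.
Qed.

Definition reduct (S T : Type) (h : S -> T) (F : frame T) : frame S :=
  Frame (world_inhabited F) (fun e => acc F (h e)).

Lemma sat_rename (S T : Type) (h : S -> T) (F : frame T) (V : nat -> F -> Prop) (f : form S) :
  forall x : F,
    @sat T (Model V) x (rename h f) <-> @sat S (@Model S (reduct h F) V) x f.
Proof.
  induction f as [p| |a IHa b IHb|e a IHa]; intros x; simpl.
  - tauto.
  - tauto.
  - rewrite IHa, IHb. tauto.
  - split; intros k y hy; apply IHa, k, hy.
Qed.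

(** The atoms of [f] are decided classically, so that a point of a model
    becomes a Boolean valuation. *)
Lemma sat_tautology (S : Type) (M : model S) (f : form S) :
  tautology f -> true_in M f.
Proof.
  intros hf x.
  set (v := fun g : form S => if excluded_middle_informative (sat x g) then true else false).
  assert (hv : forall g, prop_eval v g = true <-> sat x g).
  { induction g as [p| |a IHa b IHb|e a IHa]; simpl.
    - unfold v. destruct (excluded_middle_informative _); simpl in *; intuition congruence.
    - intuition congruence.
    - rewrite <- IHa, <- IHb.
      destruct (prop_eval v a), (prop_eval v b); simpl; intuition congruence.
    - unfold v. destruct (excluded_middle_informative _); simpl in *; intuition congruence. }
  apply hv, hf.
Qed.

Lemma valid_normal (S : Type) (F : frame S) : normal_logic (fun f => valid F f).
Proof.
  split.
  - intros f hf V. apply sat_tautology, hf.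
  - intros e V x h k y hy. exact (h y hy (k y hy)).
  - intros f g hfg hf V x. exact (hfg V x (hf V x)).
  - intros s f hf V x.
    apply (@sat_subst S (Model V) s (fun p x => @sat S (Model V) x (s p))); [tauto|].
    apply hf.
  - intros e f hf V x y _. apply hf.
Qed.

(** * Quotients and definable sets *)

Lemma cls_eq (W : Type) (sim : W -> W -> Prop) (hs : Equivalence sim) (x y : W) :
  cls sim x = cls sim y <-> sim x y.
Proof.
  split; intros h.
  - apply (f_equal (@proj1_sig _ _)) in h. simpl in h. rewrite h. reflexivity.
  - apply subset_eq_compat. apply functional_extensionality. intros z.
    apply propositional_extensionality. split; intros k.
    + transitivity x; [symmetry|]; assumption.
    + transitivity y; assumption.
Qed.

Lemma cls_onto (W : Type) (sim : W -> W -> Prop) (A : quot sim) : exists x, A = cls sim x.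
Proof. destruct A as [P [x ->]]. exists x. reflexivity. Qed.

Lemma Finite_surjection (A B : Type) (f : A -> B) :
  (forall b, exists a, f a = b) -> Finite A -> Finite B.
Proof.
  intros hf [l hl]. exists (map f l). intros b. destruct (hf b) as [a <-].
  apply in_map, hl.
Qed.

Lemma Finite_quot_coarser (W : Type) (sim sim' : W -> W -> Prop)
    (hs : Equivalence sim) (hs' : Equivalence sim')
    (hle : forall x y, sim x y -> sim' x y) :
  Finite (quot sim) -> Finite (quot sim').
Proof.
  pose (rep := fun A : quot sim =>
    proj1_sig (constructive_indefinite_description _ (cls_onto A))).
  apply Finite_surjection with (f := fun A => cls sim' (rep A)).
  intros B. destruct (cls_onto B) as [x ->]. exists (cls sim x).
  apply cls_eq; [exact hs'|]. apply hle. unfold rep.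
  destruct (constructive_indefinite_description _ _) as [y hy]; simpl.
  apply (cls_eq hs) in hy. symmetry. exact hy.
Qed.

(** By induction on [Phi]: an invariant set is split along the truth of the
    first formula, and both halves, saturated under the remaining formulas,
    are definable. *)
Lemma invariant_definable (S : Type) (M : model S) (Phi : list (form S)) :
  forall P : M -> Prop,
    (forall x y, equiv_by Phi x y -> P x -> P y) ->
    exists t, forall x, sat x t <-> P x.
Proof.
  induction Phi as [|f Phi IH]; intros P hP.
  - assert (hc : forall x y, P x -> P y) by (intros x y; apply hP; intros f []).
    destruct (classic (exists x, P x)) as [[x hx]|hn].
    + exists (Neg Bot). intros y. simpl. split; [intros _; eauto|tauto].
    + exists Bot. intros y. simpl. split; [tauto|]. intros hy. apply hn. eauto.
  - assert (hsat : forall Q : Prop -> Prop, exists t, forall x, sat x t <->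
        exists y, equiv_by Phi x y /\ Q (sat y f) /\ P y).
    { intros Q. apply IH. intros x y hxy [z [hz hQ]]. exists z. split; [|exact hQ].
      intros g hg. rewrite <- (hxy g hg). apply hz, hg. }
    destruct (hsat (fun q => q)) as [t1 h1], (hsat not) as [t0 h0].
    (* conditional on [f]: t1 if it holds, t0 otherwise *)
    exists (Neg (Imp (Imp f t1) (Neg (Imp (Neg f) t0)))). intros x. simpl.
    rewrite h1, h0. split.
    + intros h. apply NNPP. intros hn. apply h. intros k1 k0.
      destruct (classic (sat x f)) as [hf|hf].
      * destruct (k1 hf) as [y [hy [hyf hPy]]]. apply hn. apply (hP y x); [|exact hPy].
        intros g [<-|hg]; [tauto|]. symmetry. apply hy, hg.
      * destruct (k0 hf) as [y [hy [hyf hPy]]]. apply hn. apply (hP y x); [|exact hPy].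
        intros g [<-|hg]; [tauto|]. symmetry. apply hy, hg.
    + intros hx h. apply h; intros hf; exists x; (split; [intros g hg; tauto|tauto]).
Qed.

Definition modal_equiv (S : Type) (M : model S) (x y : M) : Prop :=
  forall f : form S, sat x f <-> sat y f.

Lemma list_uniform_choice (A B : Type) (Q : A -> list B -> Prop)
    (hmono : forall a P P', incl P P' -> Q a P -> Q a P') (l : list A) :
  (forall a, exists P, Q a P) -> exists P, forall a, In a l -> Q a P.
Proof.
  intros hQ. induction l as [|a l [P hP]].
  - exists nil. intros a [].
  - destruct (hQ a) as [P' hP']. exists (P' ++ P). intros b [<-|hb].
    + exact (hmono _ _ _ (incl_appl P (incl_refl P')) hP').
    + exact (hmono _ _ _ (incl_appr P' (incl_refl P)) (hP b hb)).
Qed.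

(** One distinguishing formula for each pair of inequivalent points. *)
Lemma finite_modal_equiv (S : Type) (M : model S) : Finite M ->
  exists Psi, forall x y : M, equiv_by Psi x y -> modal_equiv x y.
Proof.
  intros [l hl].
  assert (hmono : forall (x y : M) P P', incl P P' ->
      (equiv_by P x y -> modal_equiv x y) -> equiv_by P' x y -> modal_equiv x y).
  { intros x y P P' hi h k. apply h. intros f hf. apply k, hi, hf. }
  destruct (@list_uniform_choice M (form S)
    (fun x Psi => forall y, In y l -> equiv_by Psi x y -> modal_equiv x y)) with (l := l)
    as [Psi hPsi].
  - intros x P P' hi h y hy. exact (hmono x y P P' hi (h y hy)).
  - intros x. apply list_uniform_choice.
    + intros y P P'. apply hmono.
    + intros y. destruct (classic (modal_equiv x y)) as [h|h].
      * exists nil. intros _. exact h.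
      * apply not_all_ex_not in h. destruct h as [f hf]. exists (f :: nil).
        intros k. exfalso. apply hf, k. left. reflexivity.
  - exists Psi. intros x y. apply hPsi; apply hl.
Qed.

(** In a finite model in which modally equivalent points coincide, every
    subset is definable, so every valuation on its frame is a substitution. *)
Lemma differentiated_valid (S : Type) (L : form S -> Prop) (hL : normal_logic L)
    (M : model S) (hfin : Finite M) (hd : forall x y : M, modal_equiv x y -> x = y)
    (hM : Mod L M) (f : form S) : L f -> valid M f.
Proof.
  intros hf U x.
  destruct (finite_modal_equiv hfin) as [Psi hPsi].
  assert (hdef : forall p, exists t, forall y, sat y t <-> U p y).
  { intros p. apply invariant_definable with (Phi := Psi).
    intros y z hyz. rewrite (hd y z (hPsi y z hyz)). tauto. }
  pose (s := fun p => proj1_sig (constructive_indefinite_description _ (hdef p))).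
  apply (@sat_subst S M s U).
  - intros p y. unfold s.
    destruct (constructive_indefinite_description _ (hdef p)) as [t ht]; simpl.
    symmetry. apply ht.
  - apply hM. apply (nl_subst hL), hf.
Qed.

(** * Filtrations onto frames of the logic *)

Lemma subformulas_self (S : Type) (f : form S) : In f (subformulas f).
Proof. destruct f; left; reflexivity. Qed.

Lemma subformulas_closed (S : Type) (f : form S) : sub_closed (subformulas f).
Proof.
  induction f as [p| |a IHa b IHb|e a IHa]; intros g k hg hk.
  - destruct hg as [<-|[]]. exact hk.
  - destruct hg as [<-|[]]. exact hk.
  - destruct hg as [<-|hg]; [exact hk|]. right. apply in_or_app.
    apply in_app_or in hg. destruct hg as [hg|hg].
    + left. exact (IHa g k hg hk).
    + right. exact (IHb g k hg hk).
  - destruct hg as [<-|hg]; [exact hk|]. right. exact (IHa g k hg hk).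
Qed.

Lemma filtration_sat (S : Type) (G : list (form S)) (M : model S) (sim : M -> M -> Prop)
    (R : S -> quot sim -> quot sim -> Prop) (V : nat -> quot sim -> Prop)
    (hG : sub_closed G) (hfil : filtration G R V) (f : form S) :
  In f G -> forall x : M, @sat S (quot_model R V) (cls sim x) f <-> sat x f.
Proof.
  pose proof (fil_equiv hfil) as hs.
  induction f as [p| |a IHa b IHb|e a IHa]; intros hf x.
  - apply (fil_val hfil), hf.
  - simpl. tauto.
  - assert (ha : In a G).
    { apply (hG _ _ hf). right. apply in_or_app. left. apply subformulas_self. }
    assert (hb : In b G).
    { apply (hG _ _ hf). right. apply in_or_app. right. apply subformulas_self. }
    simpl. rewrite (IHa ha), (IHb hb). tauto.
  - assert (ha : In a G).
    { apply (hG _ _ hf). right. apply subformulas_self. }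
    split.
    + intros h y hy. apply (IHa ha), h. apply (fil_min hfil).
      exists x, y. repeat split; try assumption; reflexivity.
    + intros h A hA. destruct (cls_onto A) as [y ->]. apply (IHa ha).
      exact (fil_max hfil hA hf h).
Qed.

Section Collapse.

Variables (S : Type) (M : model S) (sim : M -> M -> Prop).
Variables (R : S -> quot sim -> quot sim -> Prop) (V : nat -> quot sim -> Prop).

(** Points of [M] whose classes are modally equivalent in the quotient model:
    dividing by it collapses that model to a differentiated one, still
    presented as a quotient of [M]. *)
Definition collapse (x y : M) : Prop :=
  @modal_equiv S (quot_model R V) (cls sim x) (cls sim y).

Definition collapse_rel (e : S) (A B : quot collapse) : Prop :=
  exists x y, A = cls collapse x /\ B = cls collapse y /\ R e (cls sim x) (cls sim y).

Definition collapse_val (p : nat) (A : quot collapse) : Prop :=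
  exists x, A = cls collapse x /\ V p (cls sim x).

Lemma collapse_equivalence : Equivalence collapse.
Proof.
  split.
  - intros x f. tauto.
  - intros x y h f. symmetry. apply h.
  - intros x y z h k f. rewrite (h f). apply k.
Qed.

Lemma collapse_sat (f : form S) : forall x : M,
  @sat S (quot_model collapse_rel collapse_val) (cls collapse x) f <->
  @sat S (quot_model R V) (cls sim x) f.
Proof.
  pose proof collapse_equivalence as he.
  induction f as [p| |a IHa b IHb|e a IHa]; intros x.
  - split.
    + intros [y [hy hV]]. apply (cls_eq he) in hy. apply (hy (Var p)), hV.
    + intros h. exists x. split; [reflexivity|exact h].
  - simpl. tauto.
  - simpl. rewrite (IHa x), (IHb x). tauto.
  - split.
    + intros h A hA. destruct (cls_onto A) as [y ->]. apply IHa, h.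
      exists x, y. split; [reflexivity|]. split; [reflexivity|exact hA].
    + intros h A [x' [y' [hx [-> hR]]]]. apply (cls_eq he) in hx. apply IHa.
      exact (proj1 (hx (Box e a)) h _ hR).
Qed.

Lemma collapse_differentiated (A B : quot collapse) :
  @modal_equiv S (quot_model collapse_rel collapse_val) A B -> A = B.
Proof.
  destruct (cls_onto A) as [x ->], (cls_onto B) as [y ->]. intros h.
  apply (cls_eq collapse_equivalence). intros f. rewrite <- !collapse_sat. apply h.
Qed.

Variable G : list (form S).
Hypothesis hG : sub_closed G.
Hypothesis hfil : filtration G R V.

Lemma collapse_filtration : filtration G collapse_rel collapse_val.
Proof.
  pose proof collapse_equivalence as he. pose proof (fil_equiv hfil) as hs.
  assert (hle : forall x y, sim x y -> collapse x y).
  { intros x y h. apply (cls_eq hs) in h. unfold collapse. rewrite h. intros f. tauto. }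
  assert (href : forall x y, collapse x y -> equiv_by G x y).
  { intros x y h f hf. rewrite <- !(filtration_sat hG hfil hf). apply h. }
  split.
  - exact he.
  - exact (Finite_quot_coarser hs he hle (fil_finite hfil)).
  - exact href.
  - intros p hp x. rewrite collapse_sat. apply (fil_val hfil), hp.
  - intros e x y [x' [y' [hx [hy hR]]]]. exists x', y'.
    split; [apply (cls_eq he), hx|]. split; [apply (cls_eq he), hy|].
    apply (fil_min hfil). exists x', y'. repeat split; try assumption; reflexivity.
  - intros e x y [x' [y' [hx [hy hR]]]] f hf h.
    apply (cls_eq he) in hx. apply (cls_eq he) in hy.
    assert (hf' : In f G).
    { apply (hG hf). right. apply subformulas_self. }
    apply (href _ _ hy f hf'). apply (fil_max hfil hR hf).
    apply (href _ _ hx _ hf), h.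
Qed.

(** Finitely many formulas decide modal equivalence in the finite quotient, and
    each of them holds on a union of [sim]-classes, hence on a definable set. *)
Lemma collapse_definable : definable sim -> definable collapse.
Proof.
  intros [Phi hPhi]. pose proof (fil_equiv hfil) as hs.
  destruct (@finite_modal_equiv S (quot_model R V) (fil_finite hfil)) as [Psi hPsi].
  assert (hdef : forall g, exists t, forall x : M,
      sat x t <-> @sat S (quot_model R V) (cls sim x) g).
  { intros g. apply invariant_definable with (Phi := Phi). intros x y hxy h.
    apply hPhi in hxy. apply (cls_eq hs) in hxy. rewrite <- hxy. exact h. }
  pose (t := fun g => proj1_sig (constructive_indefinite_description _ (hdef g))).
  assert (ht : forall g x, sat x (t g) <-> @sat S (quot_model R V) (cls sim x) g).
  { intros g. unfold t. exact (proj2_sig (constructive_indefinite_description _ (hdef g))). }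
  exists (map t Psi). intros x y. split.
  - intros h f hf. apply in_map_iff in hf. destruct hf as [g [<- _]].
    rewrite !ht. apply h.
  - intros h. apply hPsi. intros g hg. rewrite <- !ht. apply h, in_map, hg.
Qed.

End Collapse.

(** A quotient model of a logic may live on a frame that does not validate it.
    Collapsing the filtration removes this obstacle. *)
Lemma frame_filtration (S : Type) (L : form S -> Prop) (hL : normal_logic L)
    (hfil : admits_definable_filtration (Mod L)) (G : list (form S)) (M : model S) :
  sub_closed G -> Mod L M ->
  exists (sim : M -> M -> Prop) (R : S -> quot sim -> quot sim -> Prop)
         (V : nat -> quot sim -> Prop),
    filtration G R V /\ definable sim /\
    forall f, L f -> valid (Frame (quot_inhabited sim (world_inhabited M)) R) f.
Proof.
  intros hG hM. destruct (hfil G M hG hM) as [sim [R [V [h [hd hmod]]]]].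
  exists (collapse R V), (@collapse_rel _ _ _ R V), (@collapse_val _ _ _ R V).
  pose proof (collapse_filtration hG h) as hc.
  split; [exact hc|]. split; [exact (collapse_definable h hd)|]. intros f hf.
  apply (@differentiated_valid S L hL
    (quot_model (@collapse_rel _ _ _ R V) (@collapse_val _ _ _ R V))); [| | |exact hf].
  - exact (fil_finite hc).
  - apply collapse_differentiated.
  - intros g hg A. destruct (cls_onto A) as [x ->]. apply collapse_sat, hmod, hg.
Qed.

(** * Canonical models *)

(** Theories need not be closed under necessitation; this makes the theory
    generated by [X] and [a] simply the set of all [g] with [X (Imp a g)]. *)
Definition theory (S : Type) (L X : form S -> Prop) : Prop :=
  (forall f, L f -> X f) /\ (forall f g, X (Imp f g) -> X f -> X g).

Section Theories.

Variables (S : Type) (L : form S -> Prop).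
Hypothesis hL : normal_logic L.

Lemma theory_taut (X : form S -> Prop) (f : form S) : theory L X -> tautology f -> X f.
Proof. intros hX hf. apply hX, (nl_taut hL), hf. Qed.

Ltac tauto_by_cases :=
  let v := fresh in intros v; simpl;
  repeat match goal with |- context [prop_eval v ?a] => destruct (prop_eval v a) end;
  reflexivity.

Lemma theory_weaken (X : form S -> Prop) (a g : form S) : theory L X -> X g -> X (Imp a g).
Proof.
  intros hX. apply (proj2 hX). apply theory_taut; [exact hX|]. tauto_by_cases.
Qed.

Lemma theory_id (X : form S -> Prop) (a : form S) : theory L X -> X (Imp a a).
Proof. intros hX. apply theory_taut; [exact hX|]. tauto_by_cases. Qed.

Lemma theory_mp_under (X : form S -> Prop) (a f g : form S) : theory L X ->
  X (Imp a (Imp f g)) -> X (Imp a f) -> X (Imp a g).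
Proof.
  intros hX h. apply (proj2 hX). revert h. apply (proj2 hX).
  apply theory_taut; [exact hX|]. tauto_by_cases.
Qed.

Lemma theory_add (X : form S -> Prop) (a : form S) : theory L X ->
  theory L (fun g => X (Imp a g)).
Proof.
  intros hX. split.
  - intros f hf. apply theory_weaken; [exact hX|]. apply hX, hf.
  - intros f g. apply theory_mp_under, hX.
Qed.

Lemma theory_dne (X : form S -> Prop) (a : form S) : theory L X -> X (Neg (Neg a)) -> X a.
Proof.
  intros hX. apply (proj2 hX). apply theory_taut; [exact hX|]. tauto_by_cases.
Qed.

Lemma theory_explode (X : form S -> Prop) (a b : form S) :
  theory L X -> X (Neg a) -> X (Imp a b).
Proof.
  intros hX. apply (proj2 hX). apply theory_taut; [exact hX|]. tauto_by_cases.
Qed.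

Definition maximal_consistent (X : form S -> Prop) : Prop :=
  theory L X /\ ~ X Bot /\ forall f, X f \/ X (Neg f).

Variable code : form S -> nat.
Hypothesis code_inj : forall f g, code f = code g -> f = g.

Fixpoint stage (X : form S -> Prop) (n : nat) : form S -> Prop :=
  match n with
  | 0 => X
  | Datatypes.S n => fun g =>
      stage X n g \/ exists f, code f = n /\ ~ stage X n (Neg f) /\ stage X n (Imp f g)
  end.

Lemma stage_theory (X : form S -> Prop) (n : nat) : theory L X -> theory L (stage X n).
Proof.
  intros hX. induction n as [|n IH]; [exact hX|]. simpl. split.
  - intros f hf. left. apply IH, hf.
  - intros f g [h|[a [ha [hc h]]]] [k|[b [hb [hd k]]]].
    + left. exact (proj2 IH _ _ h k).
    + right. exists b. repeat split; trivial.
      exact (theory_mp_under IH (theory_weaken b IH h) k).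
    + right. exists a. repeat split; trivial.
      exact (theory_mp_under IH h (theory_weaken a IH k)).
    + assert (a = b) as <- by (apply code_inj; congruence).
      right. exists a. repeat split; trivial. exact (theory_mp_under IH h k).
Qed.

Lemma stage_mono (X : form S -> Prop) (m n : nat) (f : form S) :
  m <= n -> stage X m f -> stage X n f.
Proof. intros h k. induction h; [exact k|]. left. exact IHh. Qed.

Lemma stage_consistent (X : form S -> Prop) (n : nat) : ~ X Bot -> ~ stage X n Bot.
Proof.
  intros hX. induction n as [|n IH]; [exact hX|].
  intros [h|[f [_ [h k]]]]; [exact (IH h)|exact (h k)].
Qed.

(** Adding the negation of [a] to [X] beforehand turns the avoidance of [a] into
    consistency, which all stages preserve; a formula is decided one stage after
    its code. *)
Lemma lindenbaum (X : form S -> Prop) (a : form S) : theory L X -> ~ X a ->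
  exists Y, maximal_consistent Y /\ (forall f, X f -> Y f) /\ ~ Y a.
Proof.
  intros hX ha. pose (X0 := fun g => X (Imp (Neg a) g)).
  assert (h0 : theory L X0) by apply (theory_add _ hX).
  assert (hc : ~ X0 Bot) by (intros h; apply ha, (theory_dne hX h)).
  pose (Y := fun g => exists n, stage X0 n g).
  assert (hY : theory L Y).
  { split.
    - intros f hf. exists 0. apply h0, hf.
    - intros f g [m hm] [n hn]. exists (m + n).
      apply (proj2 (stage_theory (m + n) h0) f).
      + exact (stage_mono (PeanoNat.Nat.le_add_r m n) hm).
      + exact (stage_mono (PeanoNat.Nat.le_add_l n m) hn). }
  assert (hYc : ~ Y Bot) by (intros [n hn]; exact (stage_consistent hc hn)).
  exists Y. split; [|split].
  - split; [exact hY|]. split; [exact hYc|]. intros f.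
    destruct (classic (stage X0 (code f) (Neg f))) as [h|h].
    + right. exists (code f). exact h.
    + left. exists (Datatypes.S (code f)). right. exists f. split; [reflexivity|].
      split; [exact h|]. apply theory_id. apply stage_theory, h0.
  - intros f hf. exists 0. apply (theory_weaken _ hX hf).
  - intros h. apply hYc. apply (proj2 hY a); [|exact h].
    exists 0. apply (theory_id _ hX).
Qed.

Definition canonical_world : Type := {X : form S -> Prop | maximal_consistent X}.

Definition canonical_model (w : inhabited canonical_world) : model S :=
  @Model S
    (@Frame S canonical_world w
       (fun e X Y => forall f, proj1_sig X (Box e f) -> proj1_sig Y f))
    (fun p X => proj1_sig X (Var p)).

(** If [X] lacks [Box e a], the theory of all [g] with [Box e g] in [X] lacks
    [a], and any maximal extension of it lacking [a] is a successor of [X]. *)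
Lemma canonical_sat (w : inhabited canonical_world) (f : form S) :
  forall X : canonical_world, @sat S (canonical_model w) X f <-> proj1_sig X f.
Proof.
  induction f as [p| |a IHa b IHb|e a IHa]; intros X.
  - simpl. tauto.
  - simpl. split; [tauto|]. apply (proj2_sig X).
  - simpl. rewrite (IHa X), (IHb X). destruct (proj2_sig X) as [hX [hc hm]]. split.
    + intros h. destruct (hm a) as [ha|ha].
      * apply (theory_weaken _ hX), h, ha.
      * apply (theory_explode _ hX ha).
    + apply hX.
  - split.
    + intros h. apply NNPP. intros hn.
      assert (hB : theory L (fun g => proj1_sig X (Box e g))).
      { pose proof (proj1 (proj2_sig X)) as hX. split.
        - intros f hf. apply hX, (nl_nec hL), hf.
        - intros f g hfg. apply (proj2 hX). revert hfg. apply (proj2 hX).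
          apply hX.
          exact (nl_subst hL (fun n => match n with 0 => f | _ => g end) (nl_K hL e)). }
      destruct (lindenbaum hB hn) as [Y [hY [hsub ha]]].
      apply ha. apply (IHa (exist _ Y hY)), h. exact hsub.
    + intros h Y hXY. apply IHa, hXY, h.
Qed.

Lemma canonical_refutation (f : form S) : ~ L f ->
  exists M : model S, Mod L M /\ exists x : M, ~ sat x f.
Proof.
  intros hf.
  assert (hLL : theory L L) by (split; [trivial|apply (nl_mp hL)]).
  destruct (lindenbaum hLL hf) as [Y [hY [_ hYf]]].
  pose (x := exist _ Y hY : canonical_world).
  exists (canonical_model (inhabits x)). split.
  - intros g hg X. apply canonical_sat. apply (proj1 (proj2_sig X)), hg.
  - exists x. intros h. apply canonical_sat in h. exact (hYf h).
Qed.

(** * Finite model property *)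

Theorem definable_filtration_fmp :
  admits_definable_filtration (Mod L) -> finite_model_property L.
Proof.
  intros hfil. exists (fun F : frame S => Finite F /\ forall g, L g -> valid F g).
  split; [tauto|]. intros f. split; [intros hf F [_ hF]; apply hF, hf|].
  intros h. apply NNPP. intros hf.
  destruct (canonical_refutation hf) as [M [hM [x hx]]].
  pose proof (@subformulas_closed S f) as hG.
  destruct (frame_filtration hL hfil hG hM) as [sim [R [V [hF [_ hv]]]]].
  apply hx. apply (filtration_sat hG hF (subformulas_self f)).
  apply h. split; [exact (fil_finite hF)|exact hv].
Qed.

End Theories.

Lemma fmp_kripke_complete (S : Type) (L : form S -> Prop) :
  finite_model_property L -> kripke_complete L.
Proof. intros [C [_ h]]. exists C. exact h. Qed.

Fixpoint form_code (S : Type) (d : S -> nat) (f : form S) : nat :=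
  match f with
  | Var p => to_nat (0, p)
  | Bot => to_nat (1, 0)
  | Imp a b => to_nat (2, to_nat (form_code d a, form_code d b))
  | Box e a => to_nat (3, to_nat (d e, form_code d a))
  end.

Lemma form_code_inj (S : Type) (d : S -> nat) (hd : forall a b, d a = d b -> a = b)
    (f g : form S) : form_code d f = form_code d g -> f = g.
Proof.
  revert g. induction f as [p| |a IHa b IHb|e a IHa]; intros [q| |a' b'|e' a'] h;
    cbn [form_code] in h; apply to_nat_inj in h; try discriminate.
  - congruence.
  - reflexivity.
  - apply (f_equal snd) in h. cbn [snd] in h. apply to_nat_inj in h. injection h as h1 h2.
    rewrite (IHa _ h1), (IHb _ h2). reflexivity.
  - apply (f_equal snd) in h. cbn [snd] in h. apply to_nat_inj in h. injection h as h1 h2.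
    rewrite (hd _ _ h1), (IHa _ h2). reflexivity.
Qed.

(** * The logic with the transitive closure modality *)

Lemma Lplus_normal (L : form unit -> Prop) : normal_logic (Lplus L).
Proof.
  split.
  - intros f hf L' hL' _ _ _ _. exact (nl_taut hL' hf).
  - intros e L' hL' _ _ _ _. exact (nl_K hL' e).
  - intros f g hfg hf L' hL' h1 h2 h3 h4.
    exact (nl_mp hL' (hfg L' hL' h1 h2 h3 h4) (hf L' hL' h1 h2 h3 h4)).
  - intros s f hf L' hL' h1 h2 h3 h4. exact (nl_subst hL' s (hf L' hL' h1 h2 h3 h4)).
  - intros e f hf L' hL' h1 h2 h3 h4. exact (nl_nec hL' e (hf L' hL' h1 h2 h3 h4)).
Qed.

Section LplusModel.

Variables (L : form unit -> Prop) (M : model bimod).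
Hypothesis hM : Mod (Lplus L) M.

Lemma Lplus_step (a : form bimod) (x : M) :
  sat x (Box boxplus a) -> sat x (Box box a).
Proof.
  refine (@hM (subst (fun _ => a) (Imp (Box boxplus (Var 0)) (Box box (Var 0)))) _ x).
  apply (nl_subst (Lplus_normal L)). intros L' _ _ h _ _. exact h.
Qed.

Lemma Lplus_persist (a : form bimod) (x : M) :
  sat x (Box boxplus a) -> sat x (Box box (Box boxplus a)).
Proof.
  refine (@hM (subst (fun _ => a)
    (Imp (Box boxplus (Var 0)) (Box box (Box boxplus (Var 0))))) _ x).
  apply (nl_subst (Lplus_normal L)). intros L' _ _ _ h _. exact h.
Qed.

Lemma Lplus_induction (a : form bimod) (x : M) :
  true_in M (Imp a (Box box a)) -> sat x (Box box a) -> sat x (Box boxplus a).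
Proof.
  intros h.
  refine (@hM (subst (fun _ => a) (Imp (Box boxplus (Imp (Var 0) (Box box (Var 0))))
    (Imp (Box box (Var 0)) (Box boxplus (Var 0))))) _ x (fun y _ => h y)).
  apply (nl_subst (Lplus_normal L)). intros L' _ _ _ _ h'. exact h'.
Qed.

End LplusModel.

Definition trans_acc (W : Type) (R : unit -> W -> W -> Prop) (e : bimod) : W -> W -> Prop :=
  match e with
  | box => R tt
  | boxplus => clos_trans W (R tt)
  end.

Lemma clos_trans_invariant (W : Type) (R : W -> W -> Prop) (P : W -> Prop) (x y : W) :
  (forall z, R x z -> P z) -> (forall z w, P z -> R z w -> P w) ->
  clos_trans W R x y -> P y.
Proof.
  intros h0 h1 h. apply clos_trans_tn1 in h. induction h; eauto.
Qed.

Lemma trans_frame_valid (L : form unit -> Prop) (W : Type) (w : inhabited W)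
    (R : unit -> W -> W -> Prop) :
  (forall f, L f -> valid (Frame w R) f) ->
  forall f, Lplus L f -> valid (Frame w (trans_acc R)) f.
Proof.
  intros hL f hf. apply (hf _ (valid_normal _)).
  - intros g hg V x. apply (@sat_rename _ _ _ (Frame w (trans_acc R))).
    (* the [box]-reduct is the given frame up to eta on [unit] *)
    assert (hred : reduct (fun _ : unit => box) (Frame w (trans_acc R)) = Frame w R).
    { unfold reduct; simpl. f_equal. apply functional_extensionality. intros []. reflexivity. }
    revert V x. change (valid (reduct (fun _ : unit => box) (Frame w (trans_acc R))) g).
    rewrite hred. apply hL, hg.
  - intros V x h y hy. apply h. apply t_step, hy.
  - intros V x h y hy z hz. apply h. apply t_trans with y; [apply t_step, hy|exact hz].
  - intros V x h k y hy.
    assert (hp : V 0 y /\ clos_trans W (R tt) x y); [|exact (proj1 hp)].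
    apply (@clos_trans_invariant W (R tt) (fun z => V 0 z /\ clos_trans W (R tt) x z) x y);
      [| |exact hy].
    + intros z hz. split; [exact (k z hz)|apply t_step, hz].
    + intros z u [hV hz] hu. split; [exact (h z hz hV u hu)|].
      apply t_trans with z; [exact hz|apply t_step, hu].
Qed.

Section LplusFiltration.

Variables (M : model bimod) (G : list (form bimod)).

Definition abbrev (p : nat) : form bimod := nth p G Bot.

Definition abbrev_model : model unit :=
  @Model unit (reduct (fun _ => box) M) (fun p (x : M) => sat x (abbrev p)).

Lemma abbrev_sat (f : form unit) (x : M) :
  @sat unit abbrev_model x f <-> sat x (subst abbrev (embed f)).
Proof.
  rewrite <- (sat_subst (U := fun p (y : M) => sat y (abbrev p))) by tauto.
  symmetry. apply sat_rename.
Qed.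

(** Every [Box tt (Var i)] is included, not only those for boxed formulas of
    [G]: transferring [Box boxplus a] along one step of the filtered relation
    uses [box] applied to [a] and to [Box boxplus a]. *)
Definition abbrev_list : list (form unit) :=
  map Var (seq 0 (length G)) ++ map (fun i => Box tt (Var i)) (seq 0 (length G)).

Lemma abbrev_list_closed : sub_closed abbrev_list.
Proof.
  intros f g hf hg. apply in_app_or in hf. destruct hf as [hf|hf];
    apply in_map_iff in hf; destruct hf as [i [<- hi]].
  - destruct hg as [<-|[]]. apply in_or_app. left. apply in_map, hi.
  - destruct hg as [<-|[<-|[]]]; apply in_or_app.
    + right. exact (in_map (fun i => Box tt (Var i)) _ _ hi).
    + left. apply in_map, hi.
Qed.

Lemma abbrev_list_in (f : form bimod) : In f G ->
  exists i, abbrev i = f /\ In (Var i) abbrev_list /\ In (Box tt (Var i)) abbrev_list.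
Proof.
  intros hf. destruct (In_nth G f Bot hf) as [i [hi he]]. exists i.
  assert (hs : In i (seq 0 (length G))).
  { apply in_seq. split; [apply le_0_n|exact hi]. }
  split; [exact he|]. split; apply in_or_app.
  - left. apply in_map, hs.
  - right. exact (in_map (fun i => Box tt (Var i)) _ _ hs).
Qed.

Lemma abbrev_model_Mod (L : form unit -> Prop) : Mod (Lplus L) M -> Mod L abbrev_model.
Proof.
  intros hM f hf x. apply abbrev_sat. apply hM. apply (nl_subst (Lplus_normal L)).
  intros L' _ h _ _ _. apply h, hf.
Qed.

Variables (sim : M -> M -> Prop) (R : unit -> quot sim -> quot sim -> Prop).
Variable V : nat -> quot sim -> Prop.
Hypothesis hfil : @filtration unit abbrev_list abbrev_model sim R V.
Hypothesis hdef : @definable unit abbrev_model sim.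

Lemma abbrev_definable : @definable bimod M sim.
Proof.
  destruct hdef as [Phi hPhi]. exists (map (fun f => subst abbrev (embed f)) Phi).
  intros x y. rewrite (hPhi x y). split.
  - intros h f hf. apply in_map_iff in hf. destruct hf as [g [<- hg]].
    rewrite <- !abbrev_sat. apply h, hg.
  - intros h f hf. rewrite !abbrev_sat. apply h.
    exact (in_map (fun f => subst abbrev (embed f)) _ _ hf).
Qed.

Lemma abbrev_refine (x y : M) : sim x y -> equiv_by G x y.
Proof.
  intros h f hf. destruct (abbrev_list_in hf) as [i [<- [hi _]]].
  exact (fil_refine hfil h hi).
Qed.

Lemma abbrev_box (x y : M) (f : form bimod) :
  R tt (cls sim x) (cls sim y) -> In f G -> sat x (Box box f) -> sat y f.
Proof.
  intros hR hf h. destruct (abbrev_list_in hf) as [i [<- [_ hi]]].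
  exact (fil_max hfil hR hi h).
Qed.

Variable L : form unit -> Prop.
Hypothesis hG : sub_closed G.
Hypothesis hM : Mod (Lplus L) M.

(** The points of [M] whose class is reachable from that of [x] form a
    definable set closed under [box]; the induction axiom for a formula
    defining it shows that all [boxplus]-successors of [x] belong to it. *)
Lemma boxplus_reachable (x y : M) : acc M boxplus x y ->
  clos_trans _ (R tt) (cls sim x) (cls sim y).
Proof.
  intros hxy. pose proof (fil_equiv hfil : @Equivalence M sim) as hs.
  assert (hstep : forall u v : M, acc M box u v -> R tt (cls sim u) (cls sim v)).
  { intros u v huv. apply (fil_min hfil). exists u, v.
    split; [reflexivity|]. split; [reflexivity|exact huv]. }
  destruct abbrev_definable as [Phi hPhi].
  destruct (@invariant_definable bimod M Phi
    (fun z => clos_trans _ (R tt) (cls sim x) (cls sim z))) as [t ht].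
  { cbv beta. intros u v huv h. apply hPhi in huv. apply (cls_eq hs) in huv. rewrite <- huv. exact h. }
  apply ht. revert y hxy. apply (Lplus_induction hM (a := t) (x := x)).
  - intros u hu v huv. apply ht. apply t_trans with (cls sim u).
    + apply ht, hu.
    + apply t_step, hstep, huv.
  - intros z hz. apply ht. apply t_step, hstep, hz.
Qed.

(** Along a path of the filtered relation both [a] and [Box boxplus a] are
    handed on from each point to the next. *)
Lemma reachable_boxplus (x y : M) (a : form bimod) : In (Box boxplus a) G ->
  clos_trans _ (R tt) (cls sim x) (cls sim y) -> sat x (Box boxplus a) -> sat y a.
Proof.
  intros hB hxy h. pose proof (fil_equiv hfil : @Equivalence M sim) as hs.
  assert (ha : In a G) by (apply (hG hB); right; apply subformulas_self).
  assert (hstep : forall (u v : M), sat u (Box boxplus a) ->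
      R tt (cls sim u) (cls sim v) -> sat v a /\ sat v (Box boxplus a)).
  { intros u v hu hR. split.
    - exact (abbrev_box hR ha (Lplus_step hM hu)).
    - exact (abbrev_box hR hB (Lplus_persist hM hu)). }
  pose (P := fun A : quot sim =>
    forall z : M, A = cls sim z -> sat z a /\ sat z (Box boxplus a)).
  assert (hP : P (cls sim y)); [|exact (proj1 (hP y eq_refl))].
  apply (@clos_trans_invariant _ (R tt) P (cls sim x)); [| |exact hxy].
  - intros A hA z ->. exact (hstep x z h hA).
  - intros A B hA hAB z ->. destruct (cls_onto A) as [u ->].
    exact (hstep u z (proj2 (hA u eq_refl)) hAB).
Qed.

Definition quot_val (p : nat) (A : quot sim) : Prop :=
  exists x : M, A = cls sim x /\ val M p x.

Lemma trans_filtration : @filtration bimod G M sim (trans_acc R) quot_val.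
Proof.
  pose proof (fil_equiv hfil : @Equivalence M sim) as hs.
  split.
  - exact hs.
  - exact (fil_finite hfil).
  - exact abbrev_refine.
  - intros p hp x. split.
    + intros [y [hy hV]]. apply (cls_eq hs) in hy. apply (abbrev_refine hy hp), hV.
    + intros h. exists x. split; [reflexivity|exact h].
  - intros [|] x y hR.
    + exact (fil_min hfil (e := tt) hR).
    + destruct hR as [x' [y' [hx [hy hR]]]].
      apply (cls_eq hs) in hx. apply (cls_eq hs) in hy. rewrite hx, hy.
      exact (boxplus_reachable hR).
  - intros [|] x y hR f hf h.
    + apply (abbrev_box hR); [|exact h]. apply (hG hf). right. apply subformulas_self.
    + exact (reachable_boxplus hf hR h).
Qed.

End LplusFiltration.

Lemma Lplus_admits_definable_filtration (L : form unit -> Prop) :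
  normal_logic L -> admits_definable_filtration (Mod L) ->
  admits_definable_filtration (Mod (Lplus L)).
Proof.
  intros hL hadm G M hG hM.
  destruct (frame_filtration hL hadm (@abbrev_list_closed G) (@abbrev_model_Mod M G L hM))
    as [sim [R [V [hfil [hdef hv]]]]].
  exists sim, (trans_acc R), (@quot_val M sim).
  split; [exact (trans_filtration hfil hdef hG hM)|].
  split; [exact (abbrev_definable hdef)|].
  intros f hf A. exact (trans_frame_valid hv hf (V := @quot_val M sim) A).
Qed.

Theorem theorem3p9 (L : form unit -> Prop) (hL : normal_logic L)
    (hfil : admits_definable_filtration (Mod L)) :
  admits_definable_filtration (Mod (Lplus L)) /\
  finite_model_property (Lplus L) /\
  kripke_complete (Lplus L).
Proof.
  pose proof (Lplus_admits_definable_filtration hL hfil) as h1.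
  pose (d := fun e => match e with box => 0 | boxplus => 1 end).
  assert (hd : forall a b, d a = d b -> a = b).
  { intros [|] [|]; simpl; congruence. }
  assert (h2 : finite_model_property (Lplus L)).
  { exact (definable_filtration_fmp (Lplus_normal L) (form_code_inj hd) h1). }
  split; [exact h1|]. split; [exact h2|]. exact (fmp_kripke_complete h2).
Qed.
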